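(* Let $(p_1,p_2,p_3)$ and $(q_1,q_2,q_3)$ be two systems of orthogonal projectors of rank $1$ in a vector space, satisfying $\mathrm{Tr}\,p_iq_j=\frac16$ for all $i,j\in\{1,2,3\}$. Let $P=p_1+p_2+p_3$ and $Q=q_1+q_2+q_3$. Then $$\prod_{\{i,j\}\subset\{1,2,3\}}\bigl(6^2\,\mathrm{Tr}(Pq_iPq_j)-1\bigr)=\prod_{\{i,j\}\subset\{1,2,3\}}\bigl(6^2\,\mathrm{Tr}(Qp_iQp_j)-1\bigr),$$ where both products are over the three unordered pairs of distinct indices $i\neq j$ in $\{1,2,3\}$.
   Context: The base field has characteristic zero. A system of projectors is called orthogonal if the product of any two distinct projectors in the system is zero: $p_ip_{j}=0$ and $q_iq_{j}=0$ for $i\neq j$ (no Hermitian structure is involved). *)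

(* Defs.v *)
From HB Require Import structures.
From mathcomp Require Import all_boot all_algebra.
From mathcomp Require Import boolp classical_sets.

Set Implicit Arguments.
Unset Strict Implicit.
Unset Printing Implicit Defensive.

Import GRing.Theory.
Local Open Scope ring_scope.

Section Operators.
Context {F : fieldType} {V : lmodType F}.
Implicit Types (f : V -> V) (t : F).

(* V may be infinite-dimensional, so the matrix trace is not available: the
   trace of an operator of finite rank is the image of the corresponding
   element of V^* (x) V under the evaluation pairing. *)
Definition is_trace f t : Prop :=
  exists n (phi : 'I_n -> {scalar V}) (v : 'I_n -> V),
    (forall x, f x = \sum_i phi i x *: v i) /\ t = \sum_i phi i (v i).

(* Default value 0 when f has infinite rank or is not linear. *)
Definition trace f : F := xget 0 (is_trace f).

Definition rank_one f : Prop :=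
  exists2 v : V, v != 0 & range f = range (fun a : F => a *: v).

Definition orthogonal_projectors n (p : 'I_n -> {linear V -> V}) : Prop :=
  (forall i x, p i (p i x) = p i x) /\
  (forall i j x, i != j -> p i (p j x) = 0).

Lemma is_trace0 n (phi : 'I_n -> {scalar V}) (v : 'I_n -> V) :
  (forall x, \sum_i phi i x *: v i = 0) -> \sum_i phi i (v i) = 0.
Proof.
elim: n phi v => [|n IHn] phi v phi0; first by rewrite big_ord0.
have [[c [k [ck c0]]]|free_v] :=
  pselect (exists c k, c k != 0 /\ \sum_i c i *: v i = 0); last first.
  apply: big1 => i _; apply: contrapT => /eqP phi_i; apply: free_v.
  by exists (fun j => phi j (v i)), i.
pose d i := - ((c k)^-1 * c (lift k i)).
have vk : v k = \sum_i d i *: v (lift k i).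
  move: c0; rewrite (bigD1_ord k) //= => /eqP; rewrite addr_eq0 => /eqP c0.
  rewrite -[LHS]scale1r -(mulVf ck) -scalerA c0 -sumrN scaler_sumr.
  by apply: eq_bigr => i _; rewrite /d scalerN scalerA scaleNr.
have lin i : scalar (fun x => phi (lift k i) x + d i * phi k x).
  by move=> a x y; rewrite !linearP /= !mulrDr mulrCA addrACA.
pose psi i : {scalar V} :=
  HB.pack (fun x => phi (lift k i) x + d i * phi k x)
    (GRing.isLinear.Build F V F _ _ (lin i)).
rewrite -[RHS](IHn psi (fun i => v (lift k i))) => [|x].
  rewrite (bigD1_ord k) //= [X in phi k X]vk raddf_sum -big_split /=; apply: eq_bigr => i _.
  by rewrite linearZ /= addrC.
rewrite -[RHS](phi0 x) [RHS](bigD1_ord k) //= vk scaler_sumr -big_split /=.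
by apply: eq_bigr => i _; rewrite scalerDl scalerA addrC [d i * _]mulrC.
Qed.

Lemma is_trace_unique f t u : is_trace f t -> is_trace f u -> t = u.
Proof.
move=> [m [phi [v [fE ->]]]] [n [psi [w [fE' ->]]]].
pose chi (i : 'I_(m + n)) :=
  match split i with inl j => phi j | inr j => psi j end.
pose z (i : 'I_(m + n)) :=
  match split i with inl j => v j | inr j => - w j end.
have lE i : split (lshift n i) = inl i :> 'I_m + 'I_n.
  exact: (unsplitK (inl i)).
have rE i : split (rshift m i) = inr i :> 'I_m + 'I_n.
  exact: (unsplitK (inr i)).
have chiz : \sum_i chi i (z i) = 0.
  apply: is_trace0 => x; rewrite big_split_ord /=.
  under eq_bigr do rewrite /chi /z lE.
  under [X in _ + X]eq_bigr do rewrite /chi /z rE scalerN.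
  by rewrite sumrN -fE -fE' subrr.
apply/eqP; rewrite -subr_eq0 -[X in _ == X]chiz big_split_ord /=; apply/eqP.
under [in RHS]eq_bigr do rewrite /chi /z lE.
under [X in _ = _ + X]eq_bigr do rewrite /chi /z rE raddfN.
by rewrite sumrN.
Qed.

Lemma traceE f t : is_trace f t -> trace f = t.
Proof. by move=> ft; apply: xget_unique => // u /is_trace_unique; exact. Qed.

End Operators.

Lemma trace_mulmxr (F : fieldType) n (A : 'M[F]_n) :
  trace (fun u : 'rV[F]_n => u *m A) = \tr A.
Proof.
apply: traceE.
have lin (i : 'I_n) : scalar (fun u : 'rV[F]_n => u 0 i).
  by move=> a u v; rewrite !mxE.
pose phi i : {scalar 'rV[F]_n} :=
  HB.pack (fun u : 'rV[F]_n => u 0 i)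
    (GRing.isLinear.Build F 'rV[F]_n F _ _ (lin i)).
exists n, phi, (fun i => row i A); split=> [u|].
  by rewrite mulmx_sum_row.
by apply: eq_bigr => i _; rewrite /= mxE.
Qed.

(* Main.v *)
(** Write [p i x = alpha i x *: a i] and [q j x = beta j x *: b j].  With
    [x i j = alpha i (b j)] the trace hypothesis says that [beta j (a i)] is the
    inverse of [6 * x i j], so [6^2 Tr(P q_i P q_j)] is
    [(\sum_l x l j / x l i) * (\sum_l x l i / x l j)].  The identity
    [(u+v+w)(1/u+1/v+1/w) - 1 = (u+v)(v+w)(w+u)/(uvw)] turns each factor of the
    left-hand side into the product of the three 2x2 permanents of [x] on two
    columns, divided by the entries of these columns.  The whole product is then
    the product of all nine 2x2 permanents of [x] divided by the square of the
    product of its entries, which is invariant under transposition. *)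
From HB Require Import structures.
Require Import Defs.
From mathcomp Require Import all_boot all_algebra.
From mathcomp Require Import boolp classical_sets.
From mathcomp Require Import ring.

Set Implicit Arguments.
Unset Strict Implicit.
Unset Printing Implicit Defensive.

Import GRing.Theory.
Local Open Scope ring_scope.

(** Since [v != 0], the coefficient along [v] is unique, which makes its pointwise choice linear.
    Vector and form are packed in one pair so that a single use of [choice] serves a whole
    family. *)
Lemma rank_one_form (F : fieldType) (V : lmodType F) (f : {linear V -> V}) :
  rank_one f -> exists vphi : V * {scalar V}, forall x, f x = vphi.2 x *: vphi.1.
Proof.
case=> v v0 rf.
have /choice[c cE] : forall x, exists c, f x = c *: v.
  move=> x; have : range f (f x) by exists x.
  by rewrite rf => -[c _ <-]; exists c.
have lin : scalar c.
  move=> t x y; apply/eqP; rewrite -subr_eq0.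
  have /eqP : (c (t *: x + y) - (t * c x + c y)) *: v = 0.
    by rewrite scalerBl scalerDl -scalerA -!cE linearP subrr.
  by rewrite scaler_eq0 (negPf v0) orbF.
pose phi : {scalar V} := HB.pack c (GRing.isLinear.Build F V F _ _ lin).
by exists (v, phi).
Qed.

Lemma trace_form (F : fieldType) (V : lmodType F) (f : V -> V)
    (phi : {scalar V}) (v : V) :
  (forall x, f x = phi x *: v) -> trace f = phi v.
Proof.
move=> fE; apply: traceE; exists 1%N, (fun=> phi), (fun=> v).
by split=> [x|]; rewrite big_ord1.
Qed.

(** The rightmost factor [q j] already sends everything to the line of [b j], so the composite is
    [beta j] times a fixed vector and its trace is a single evaluation. *)
Lemma trace_sandwich (F : fieldType) (V : lmodType F) n
    (p q : 'I_n -> {linear V -> V}) (a b : 'I_n -> V)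
    (alpha beta : 'I_n -> {scalar V})
    (pE : forall i x, p i x = alpha i x *: a i)
    (qE : forall i x, q i x = beta i x *: b i) i j :
  let P := fun x : V => \sum_(k < n) p k x in
  trace (P \o q i \o P \o q j) =
  (\sum_l alpha l (b j) * beta i (a l)) * (\sum_l alpha l (b i) * beta j (a l)).
Proof.
move=> P.
have PZ c x : P (c *: x) = c *: P x.
  by rewrite /P scaler_sumr; apply: eq_bigr => k _; rewrite linearZ.
have betaP k x : beta k (P x) = \sum_l alpha l x * beta k (a l).
  by rewrite /P raddf_sum; apply: eq_bigr => l _; rewrite pE /= linearZ.
rewrite (@trace_form _ _ _ (beta j) (P (q i (P (b j))))) => [|x].
  by rewrite qE PZ linearZ /= !betaP.
by rewrite /= (qE j) PZ linearZ PZ.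
Qed.

Lemma sum_ratio_pred (F : fieldType) (u v : 'I_3 -> F) :
  (forall l, u l != 0) -> (forall l, v l != 0) ->
  (\sum_l u l / v l) * (\sum_l v l / u l) - 1 =
  (\prod_(l < 3) \prod_(m < 3 | (l < m)%N) (u l * v m + u m * v l)) /
  \prod_l (u l * v l).
Proof.
move=> u0 v0; under [X in _ = X / _]eq_bigr do rewrite big_mkcond.
rewrite !big_ord_recl !big_ord0 /=.
by field; rewrite !u0 !v0.
Qed.

Lemma exchange_prod_pairs (F : fieldType) n (f : 'I_n -> 'I_n -> 'I_n -> 'I_n -> F) :
  \prod_(i < n) \prod_(j < n | (i < j)%N)
    \prod_(l < n) \prod_(m < n | (l < m)%N) f i j l m =
  \prod_(l < n) \prod_(m < n | (l < m)%N)
    \prod_(i < n) \prod_(j < n | (i < j)%N) f i j l m.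
Proof.
rewrite pair_big_dep [RHS]pair_big_dep /=.
under eq_bigr do rewrite pair_big_dep.
under [RHS]eq_bigr do rewrite pair_big_dep.
exact: exchange_big.
Qed.

Lemma prod_sum_ratio_pred_tr (F : fieldType) (x : 'I_3 -> 'I_3 -> F) :
  (forall i j, x i j != 0) ->
  \prod_(i < 3) \prod_(j < 3 | (i < j)%N)
    ((\sum_l x l j / x l i) * (\sum_l x l i / x l j) - 1) =
  \prod_(i < 3) \prod_(j < 3 | (i < j)%N)
    ((\sum_l x i l / x j l) * (\sum_l x j l / x i l) - 1).
Proof.
move=> x0.
under eq_bigr do under eq_bigr do
  rewrite (sum_ratio_pred (fun l => x0 l _) (fun l => x0 l _)).
under [RHS]eq_bigr do under eq_bigr do
  rewrite (sum_ratio_pred (x0 _) (x0 _)).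
under eq_bigr do rewrite prodf_div.
under [RHS]eq_bigr do rewrite prodf_div.
rewrite !prodf_div; congr (_ / _).
  (* Numerators: once row pairs and column pairs are exchanged, the 2x2 permanents match factor by
     factor. *)
  rewrite exchange_prod_pairs.
  by do 4![apply: eq_bigr => ? _]; ring.
(* Denominators: every index lies in two of the three pairs, so each entry of [x] occurs exactly
   twice on both sides. *)
under eq_bigr do rewrite big_mkcond.
under [RHS]eq_bigr do rewrite big_mkcond.
by rewrite !big_ord_recl !big_ord0 /=; ring.
Qed.

Theorem proposition7 (F : fieldType) (charF0 : [pchar F] =i pred0)
    (V : lmodType F) (p q : 'I_3 -> {linear V -> V})
    (orth_p : orthogonal_projectors p) (rank_p : forall i, rank_one (p i))
    (orth_q : orthogonal_projectors q) (rank_q : forall i, rank_one (q i))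
    (tr_pq : forall i j, trace (p i \o q j) = 6%:R^-1) :
  let P := fun x : V => \sum_(i < 3) p i x in
  let Q := fun x : V => \sum_(i < 3) q i x in
  \prod_(i < 3) \prod_(j < 3 | (i < j)%N)
      (6%:R ^+ 2 * trace (P \o q i \o P \o q j) - 1) =
  \prod_(i < 3) \prod_(j < 3 | (i < j)%N)
      (6%:R ^+ 2 * trace (Q \o p i \o Q \o p j) - 1).
Proof.
have n6 : 6%:R != 0 :> F by rewrite ((pcharf0P F).1 charF0).
have /choice[fa faE] := fun i => rank_one_form (rank_p i).
have /choice[fb fbE] := fun i => rank_one_form (rank_q i).
pose x i j := (fa i).2 (fb j).1.
have xy i j : x i j * (fb j).2 (fa i).1 = 6%:R^-1.
  rewrite -(tr_pq i j) (@trace_form _ _ _ (fb j).2 (x i j *: (fa i).1)) => [|z].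
    by rewrite linearZ.
  by rewrite /= fbE linearZ faE.
have x0 i j : x i j != 0.
  by apply: contraNneq (invr_neq0 n6) => xij0; rewrite -(xy i j) xij0 mul0r.
have yE i j : (fb j).2 (fa i).1 = 6%:R^-1 / x i j.
  by rewrite -(xy i j) mulrC mulKf.
(* The factor [6 ^+ 2] absorbs the [6^-1] that [yE] brings into each of the two sums. *)
have scale u v : 6%:R ^+ 2 * ((6%:R^-1 * u) * (6%:R^-1 * v)) = u * v :> F.
  by field.
move=> P Q.
have LE i j : 6%:R ^+ 2 * trace (P \o q i \o P \o q j) =
    (\sum_l x l j / x l i) * (\sum_l x l i / x l j).
  rewrite (trace_sandwich faE fbE) -[RHS]scale.
  by congr (_ * (_ * _)); rewrite mulr_sumr; apply: eq_bigr => l _; rewrite yE mulrCA.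
(* Swapping the two families puts the inverse entries on the [alpha] side, so the sums now run along
   rows of [x]. *)
have RE i j : 6%:R ^+ 2 * trace (Q \o p i \o Q \o p j) =
    (\sum_l x i l / x j l) * (\sum_l x j l / x i l).
  rewrite (trace_sandwich fbE faE) -[RHS]scale.
  by congr (_ * (_ * _)); rewrite mulr_sumr; apply: eq_bigr => l _; rewrite yE mulrAC mulrA.
under eq_bigr do under eq_bigr do rewrite LE.
under [RHS]eq_bigr do under eq_bigr do rewrite RE.
exact: prod_sum_ratio_pred_tr.
Qed.
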